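(* Let $(V,e)$ be a monotone complete absolute order unit space in which $OP(V)$ covers $V$, and let $v \in V$. Then there exists a unique family $\{e_{\alpha} : \alpha \in \mathbb{R}\} \subset OP(V)$ such that (1) $\{e_{\alpha} : \alpha\in\mathbb{R}\}$ is increasing, i.e. $e_\alpha \le e_\beta$ whenever $\alpha \le \beta$; (2) $e_{\alpha} = 0$ if $\alpha < -\Vert v\Vert$ and $e_{\alpha} = e$ if $\alpha \ge \Vert v\Vert$; (3) $v \in AC(e_{\alpha})$ for every $\alpha \in \mathbb{R}$; (4) $C_{e_{\alpha}}(v) \le \alpha e_{\alpha}$ and $C_{e_{\alpha}}^{\prime}(v) \ge \alpha e_{\alpha}^{\prime}$ for each $\alpha \in \mathbb{R}$; (5) for each $\alpha\in\mathbb{R}$, if $v \in AC(p)$ for some $p \in OP(V)$ and if $C_p(v) \le \alpha p$ and $C_p^{\prime}(v) \ge \alpha p^{\prime}$, then $p \le e_{\alpha}$; (6) $\bigwedge_{\alpha > \alpha_0} e_{\alpha} = e_{\alpha_0}$ for each $\alpha_0 \in \mathbb{R}$.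
   Context: A real ordered vector space is a real vector space $V$ with a cone $V^+$ (closed under addition and multiplication by nonnegative reals); $v\le w$ means $w-v\in V^+$; $[v,w]=\{x: v\le x\le w\}$. An absolutely ordered space is a real ordered vector space with a map $|\cdot|:V\to V^+$ such that: (i) $|v|=v$ if $v\in V^+$; (ii) $|v|\pm v\in V^+$; (iii) $|kv|=|k||v|$ for $k\in\mathbb{R}$; (iv) if $|u-v|=u+v$ and $0\le w\le v$, then $|u-w|=u+w$; (v) if $|u-v|=u+v$ and $|u-w|=u+w$, then $\big|u-|v\pm w|\big|=u+|v\pm w|$. For $u,v\in V^+$, $u\perp v$ means $|u-v|=u+v$. For a norm on $V$ and $u,v\in V^+$, $u\perp_\infty v$ means $\Vert\alpha u+\beta v\Vert=\max(\Vert\alpha u\Vert,\Vert\beta v\Vert)$ for all $\alpha,\beta\in\mathbb{R}$; $u\perp_\infty^a v$ means $u_1\perp_\infty v_1$ whenever $0\le u_1\le u$, $0\le v_1\le v$. An absolute order unit space $(V,e)$ is an absolutely ordered space with $V^+$ proper and generating and an order unit $e$ (for each $v$ there is $k>0$ with $ke\pm v\in V^+$) such that $\Vert v\Vert=\inf\{k>0: ke\pm v\in V^+\}$ is a norm for which $V^+$ is closed, $u\le v\le w$ implies $\Vert v\Vert\le\max(\Vert u\Vert,\Vert w\Vert)$, and for $u,v\in V^+$: $u\perp v$ if and only if $u\perp_\infty^a v$. Order projections: $OP(V)=\{p\in[0,e]: p\perp(e-p)\}$; $p'=e-p$. For $u\in V^+$, $V_u=\{v\in V: ku\pm v\in V^+\text{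 for some }k>0\}$. For $p\in OP(V)$, $AC(p)=V_p+V_{p'}$; every $v\in AC(p)$ has a unique decomposition $v=v_p+v_{p'}$ with $v_p\in V_p$, $v_{p'}\in V_{p'}$, and one writes $C_p(v)=v_p$, $C_p'(v)=v_{p'}$. $p\in OP(V)$ covers $v\in V$ if $v\in V_p$ and $V_p\subset V_q$ whenever $q\in OP(V)$ and $v\in V_q$. $OP(V)$ covers $V$ if every $v\in V$ has a cover in $OP(V)$, and $p_1\perp_\infty^a p_2$ whenever $p_i$ is the cover of $v_i\in V^+$ ($i=1,2$) and $v_1\perp_\infty^a v_2$. $V$ is monotone complete if every increasing net in $V$ that is bounded above has a supremum in $V$ (equivalently every decreasing net bounded below has an infimum). $\bigwedge$ denotes the greatest lower bound in $V$. *)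

(* Defs.v *)
From HB Require Import structures.
From mathcomp Require Import all_boot all_order all_algebra.
From mathcomp Require Import all_classical all_reals all_analysis.

Set Implicit Arguments.
Unset Strict Implicit.
Unset Printing Implicit Defensive.

Import Order.TTheory GRing.Theory Num.Theory.
Import numFieldNormedType.Exports.

Local Open Scope classical_set_scope.
Local Open Scope ring_scope.

Reserved Notation "v <=_V w" (at level 70, w at next level).

(* The cone [vpos] need not be proper, so [vle] below is in general only a
   preorder and MathComp's order structures on [V] are not used. *)
HB.mixin Record isOrderedVect (R : realType) V & GRing.Lmodule R V := {
  vpos : set V;
  vpos0 : vpos 0;
  vposD : forall u v, vpos u -> vpos v -> vpos (u + v);
  vposZ : forall (k : R) v, 0 <= k -> vpos v -> vpos (k *: v)
}.

#[short(type="orderedVectType")]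
HB.structure Definition OrderedVect (R : realType) :=
  {V of GRing.Lmodule R V & isOrderedVect R V}.

Definition vle (R : realType) (V : orderedVectType R) (v w : V) : Prop :=
  vpos (w - v).

Notation "v <=_V w" := (vle v w) : ring_scope.

(* [`|v|] is reserved for the norm; the absolute value in V is [vabs v]. *)
HB.mixin Record isAbsolutelyOrdered (R : realType) V & OrderedVect R V := {
  vabs : V -> V;
  vabs_pos : forall v : V, vpos (vabs v);
  vabs_id : forall v : V, vpos v -> vabs v = v;
  vabsD_pos : forall v : V, vpos (vabs v + v);
  vabsB_pos : forall v : V, vpos (vabs v - v);
  vabsZ : forall (k : R) (v : V), vabs (k *: v) = `|k| *: vabs v;
  vabs_orth_le : forall u v w : V, vabs (u - v) = u + v ->
    0 <=_V w -> w <=_V v -> vabs (u - w) = u + w;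
  vabs_orthD : forall u v w : V,
    vabs (u - v) = u + v -> vabs (u - w) = u + w ->
    vabs (u - vabs (v + w)) = u + vabs (v + w);
  vabs_orthB : forall u v w : V,
    vabs (u - v) = u + v -> vabs (u - w) = u + w ->
    vabs (u - vabs (v - w)) = u + vabs (v - w)
}.

#[short(type="absOrderedType")]
HB.structure Definition AbsOrdered (R : realType) :=
  {V of OrderedVect R V & isAbsolutelyOrdered R V}.

#[short(type="normedOrderedVectType")]
HB.structure Definition NormedOrderedVect (R : realType) :=
  {V of OrderedVect R V & NormedModule R V}.

#[short(type="normedAbsOrderedType")]
HB.structure Definition NormedAbsOrdered (R : realType) :=
  {V of AbsOrdered R V & NormedModule R V}.

(* The relations [perp], [perp_infty] and [perp_infty_a] are only meaningful
   for [u] and [v] in the cone. *)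
Definition perp (R : realType) (V : absOrderedType R) (u v : V) : Prop :=
  vabs (u - v) = u + v.

Definition perp_infty (R : realType) (V : normedOrderedVectType R) (u v : V) :
    Prop :=
  forall a b : R, `|a *: u + b *: v| = Num.max `|a *: u| `|b *: v|.

Definition perp_infty_a (R : realType) (V : normedOrderedVectType R)
    (u v : V) : Prop :=
  forall u1 v1 : V, 0 <=_V u1 -> u1 <=_V u -> 0 <=_V v1 -> v1 <=_V v ->
    perp_infty u1 v1.

(* In a [normedModType] the topology is the one induced by the norm.  Hence
   requiring the norm to satisfy [ounormE] says exactly that the infimum
   defines a norm on V, with respect to which the cone is closed. *)
HB.mixin Record isAbsOrderUnit (R : realType) V & NormedAbsOrdered R V := {
  ounit : V;
  vpos_proper : forall v : V, vpos v -> vpos (- v) -> v = 0;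
  vpos_generating :
    forall v : V, exists u w : V, [/\ vpos u, vpos w & v = u - w];
  ounitP : forall v : V, exists k : R,
    [/\ 0 < k, vpos (k *: ounit + v) & vpos (k *: ounit - v)];
  ounormE : forall v : V, `|v| =
    inf [set k : R | [/\ 0 < k, vpos (k *: ounit + v)
                                & vpos (k *: ounit - v)]];
  vpos_closed : closed (vpos : set V);
  ounorm_between : forall u v w : V,
    u <=_V v -> v <=_V w -> `|v| <= Num.max `|u| `|w|;
  perpP : forall u v : V, vpos u -> vpos v -> perp u v <-> perp_infty_a u v
}.

#[short(type="absOrderUnitType")]
HB.structure Definition AbsOrderUnit (R : realType) :=
  {V of NormedAbsOrdered R V & isAbsOrderUnit R V}.

Section OrderProjections.
Context (R : realType) (V : absOrderUnitType R).
Implicit Types (p u v : V).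

Definition oproj_compl p : V := ounit - p.

Definition oproj : set V :=
  [set p : V | [/\ 0 <=_V p, p <=_V ounit & perp p (oproj_compl p)]].

(* V_u *)
Definition vface u : set V :=
  [set v : V | exists k : R,
    [/\ 0 < k, vpos (k *: u + v) & vpos (k *: u - v)]].

Definition abs_compat_decomposition p v (ab : V * V) : Prop :=
  [/\ vface p ab.1, vface (oproj_compl p) ab.2 & v = ab.1 + ab.2].

(* AC(p) = V_p + V_{p'} *)
Definition abs_compat p : set V :=
  [set v : V | exists ab : V * V, abs_compat_decomposition p v ab].

(* C_p(v) and C_p'(v); they take the junk value 0 when [v] is not
   in [abs_compat p]. *)
Definition compression p v : V :=
  (xget (0, 0) (abs_compat_decomposition p v)).1.
Definition compression_compl p v : V :=
  (xget (0, 0) (abs_compat_decomposition p v)).2.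

Definition covers p v : Prop :=
  [/\ oproj p, vface p v &
      forall q : V, oproj q -> vface q v -> vface p `<=` vface q].

End OrderProjections.

Definition oproj_covers (R : realType) (V : absOrderUnitType R) : Prop :=
  (forall v : V, exists p : V, covers p v) /\
  (forall p1 p2 v1 v2 : V, vpos v1 -> vpos v2 -> covers p1 v1 ->
    covers p2 v2 -> perp_infty_a v1 v2 -> perp_infty_a p1 p2).

Definition is_vsup (R : realType) (V : orderedVectType R) (A : set V) (s : V) :
    Prop :=
  (forall x, A x -> x <=_V s) /\
  (forall b : V, (forall x, A x -> x <=_V b) -> s <=_V b).

Definition is_vinf (R : realType) (V : orderedVectType R) (A : set V) (s : V) :
    Prop :=
  (forall x, A x -> s <=_V x) /\
  (forall b : V, (forall x, A x -> b <=_V x) -> b <=_V s).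

Definition directed_preorder (I : Type) (leI : I -> I -> Prop) : Prop :=
  [/\ inhabited I, forall i, leI i i,
      forall i j k, leI i j -> leI j k -> leI i k &
      forall i j, exists k, leI i k /\ leI j k].

Definition monotone_complete (R : realType) (V : orderedVectType R) : Prop :=
  forall (I : Type) (leI : I -> I -> Prop) (x : I -> V),
    directed_preorder leI ->
    (forall i j, leI i j -> x i <=_V x j) ->
    (exists b : V, forall i, x i <=_V b) ->
    exists s : V, is_vsup (range x) s.

(* Main.v *)
Require Import Defs.
From mathcomp Require Import all_boot all_order all_algebra.
From mathcomp Require Import all_classical all_reals all_analysis.
From mathcomp Require Import lra.

(* Take [e_a = e - q_a], where [q_a] is the cover of [(v - a e)^+].  Orthogonal
   elements [u, w] of [[0, e]] satisfy [u + w <= e], because their norms combine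
   as a maximum; hence for a projection [p] and [x >= 0], [x] is orthogonal to
   [p] exactly when [x] lies in the face of [e - p].  Therefore [(v - a e)^-]
   lives under [e_a], which gives the decomposition of [v], and any competitor
   [p] in (5) yields the same Jordan decomposition of [v - a e], so that
   [q_a <= e - p].  Property (5) determines the family.  Only the right
   continuity uses monotone completeness. *)

Set Implicit Arguments.
Unset Strict Implicit.
Unset Printing Implicit Defensive.

Import Order.TTheory GRing.Theory Num.Theory.
Import numFieldNormedType.Exports.

Local Open Scope classical_set_scope.
Local Open Scope ring_scope.

(** * Arithmetic of the cone preorder *)

Section OrderedVectTheory.
Context (R : realType) (V : orderedVectType R).
Implicit Types (u v w x y : V) (k l : R).

Lemma vle0r x : (0 <=_V x) = vpos x.
Proof. by rewrite /vle subr0. Qed.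

Lemma vle_refl x : x <=_V x.
Proof. by rewrite /vle subrr; exact: vpos0. Qed.

Lemma vle_trans y x z : x <=_V y -> y <=_V z -> x <=_V z.
Proof. by move=> xy yz; rewrite /vle -(subrKA y); exact: vposD. Qed.

Lemma vleD x y u v : x <=_V y -> u <=_V v -> x + u <=_V y + v.
Proof. by move=> xy uv; rewrite /vle opprD addrACA; exact: vposD. Qed.

Lemma vleBRL x y z : (x + y <=_V z) = (x <=_V z - y).
Proof. by rewrite /vle opprD addrA addrAC. Qed.

Lemma vleBLR x y z : (x - y <=_V z) = (x <=_V z + y).
Proof. by rewrite vleBRL opprK. Qed.

Lemma vleN x y : (- x <=_V - y) = (y <=_V x).
Proof. by rewrite /vle opprK addrC. Qed.

Lemma vleBC x y z : (x <=_V z - y) = (y <=_V z - x).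
Proof. by rewrite -!vleBRL addrC. Qed.

Lemma vleB2l x y z : y <=_V z -> x - z <=_V x - y.
Proof. by move=> yz; apply: vleD; [exact: vle_refl | rewrite vleN]. Qed.

Lemma vleZ k x y : 0 <= k -> x <=_V y -> k *: x <=_V k *: y.
Proof. by move=> k0 xy; rewrite /vle -scalerBr; exact: vposZ. Qed.

Lemma vle_scale k l x : vpos x -> k <= l -> k *: x <=_V l *: x.
Proof. by move=> x0 kl; rewrite /vle -scalerBl; apply: vposZ; rewrite ?subr_ge0. Qed.

Lemma vle_addl x y : vpos y -> x <=_V x + y.
Proof. by move=> y0; rewrite /vle addrAC subrr add0r. Qed.

Lemma vle_pos x y : vpos x -> x <=_V y -> vpos y.
Proof. by rewrite -!vle0r; exact: vle_trans. Qed.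

End OrderedVectTheory.

(** * Orthogonality, absolute value and Jordan decomposition *)

Section AbsOrderedTheory.
Context (R : realType) (V : absOrderedType R).
Implicit Types (u v w x y : V) (k l : R).

Lemma vabsN x : vabs (- x) = vabs x.
Proof. by rewrite -scaleN1r vabsZ normrN1 scale1r. Qed.

Lemma perp_sym u v : perp u v -> perp v u.
Proof. by rewrite /perp -vabsN opprB [v + u]addrC. Qed.

Lemma perp_ler u v w : perp u v -> vpos w -> w <=_V v -> perp u w.
Proof. by move=> uv w0 wv; apply: vabs_orth_le uv _ wv; rewrite vle0r. Qed.

Lemma perp_lel u v w : perp u v -> vpos w -> w <=_V u -> perp w v.
Proof. by move=> uv w0 wu; apply/perp_sym/(perp_ler (perp_sym uv)). Qed.

(** Scaling both elements by [Num.max 1 k] preserves [perp]; they are then shrunk to [u] and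
    [k *: v]. *)
Lemma perpZr u v k : vpos u -> vpos v -> 0 <= k -> perp u v -> perp u (k *: v).
Proof.
move=> u0 v0 k0 uv.
have l0 : 0 <= Num.max 1 k by rewrite le_max ler01.
have P : perp (Num.max 1 k *: u) (Num.max 1 k *: v).
  by rewrite /perp -scalerBr vabsZ uv ger0_norm // scalerDr.
apply: (perp_lel (v := k *: v) (u := Num.max 1 k *: u)) => //.
  apply: perp_ler P _ _; first exact: vposZ.
  by apply: vle_scale; rewrite // le_max lexx orbT.
by rewrite -{1}[u]scale1r; apply: vle_scale; rewrite // le_max lexx.
Qed.

Lemma perp_absD u v w : perp u v -> perp u w -> perp u (vabs (v + w)).
Proof. exact: vabs_orthD. Qed.

Lemma perp_absB u v w : perp u v -> perp u w -> perp u (vabs (v - w)).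
Proof. exact: vabs_orthB. Qed.

Lemma perpD u v w : vpos v -> vpos w -> perp u v -> perp u w -> perp u (v + w).
Proof.
by move=> v0 w0 uv uw; have := perp_absD uv uw; rewrite vabs_id //; exact: vposD.
Qed.

Lemma perp0l x : vpos x -> perp 0 x.
Proof. by move=> x0; rewrite /perp sub0r vabsN add0r vabs_id. Qed.

Lemma vabs_double x : vabs (x + x) = vabs x + vabs x.
Proof. by rewrite -mulr2n -scaler_nat vabsZ normr_nat scaler_nat mulr2n. Qed.

(** The positive part of [x]; the negative part is [vpospart (- x)]. *)
Definition vpospart x : V := 2^-1 *: (vabs x + x).

Lemma half_double x : 2^-1 *: (x + x) = x.
Proof. by rewrite -mulr2n -(scaler_nat _ x) scalerA mulVf ?scale1r ?pnatr_eq0. Qed.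

Lemma vpospart_pos x : vpos (vpospart x).
Proof. by apply: vposZ (vabsD_pos x); rewrite invr_ge0. Qed.

Lemma vpospartB x : vpospart x - vpospart (- x) = x.
Proof.
by rewrite /vpospart vabsN -scalerBr opprB addrC addrA addrNK half_double.
Qed.

Lemma vpospartD x : vpospart x + vpospart (- x) = vabs x.
Proof.
by rewrite /vpospart vabsN -scalerDr addrACA subrr addr0 half_double.
Qed.

Lemma perp_pospart x : perp (vpospart x) (vpospart (- x)).
Proof. by rewrite /perp vpospartB vpospartD. Qed.

Lemma vle_pospart x : x <=_V vpospart x.
Proof.
by rewrite -{1}[x]vpospartB vleBLR; exact/vle_addl/vpospart_pos.
Qed.

Lemma vpospart_le_abs x : vpospart x <=_V vabs x.
Proof. by rewrite -vpospartD; exact/vle_addl/vpospart_pos. Qed.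

(** Uniqueness of the Jordan decomposition: [perp u w] computes the absolute value of [u - w]. *)
Lemma vpospart_eq u w : perp u w -> vpospart (u - w) = u.
Proof. by move=> uw; rewrite /vpospart uw addrACA subrr addr0 half_double. Qed.

Lemma vpospart_id x : vpos x -> vpospart x = x.
Proof. by move=> x0; rewrite /vpospart vabs_id ?half_double. Qed.

Lemma vpospart_npos x : vpos (- x) -> vpospart x = 0.
Proof. by move=> x0; rewrite -[x]opprK -sub0r vpospart_eq //; exact: perp0l. Qed.

(* If [x] and [z] have orthogonal supports, then [z - x] has the Jordan
   decomposition [z^+ - (x + z^-)]. *)
Lemma vpospart_sub x z : vpos x -> perp x (vabs z) -> vpospart (z - x) = vpospart z.
Proof.
move=> x0 xz; have -> : z - x = vpospart z - (x + vpospart (- z)).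
  by rewrite -{1}[z]vpospartB opprD addrA addrAC.
apply: vpospart_eq; apply: perpD => //.
- exact: vpospart_pos.
- by apply/perp_sym/(perp_ler xz)/vpospart_le_abs/vpospart_pos.
- exact: perp_pospart.
Qed.

End AbsOrderedTheory.

(** * The order unit norm *)

Section AbsOrderUnitTheory.
Context (R : realType) (V : absOrderUnitType R).
Implicit Types (u v w x y z p q : V) (k l a : R).

Local Notation e := (@ounit R V).

Lemma vle_anti x y : x <=_V y -> y <=_V x -> x = y.
Proof.
by move=> xy yx; apply/eqP; rewrite -subr_eq0; apply/eqP/vpos_proper; rewrite ?opprB.
Qed.

Lemma ounit_pos : vpos e.
Proof.
have [k [k0 ke _]] := @ounitP R V 0.
have -> : e = k^-1 *: (k *: e + 0) by rewrite addr0 scalerA mulVf ?scale1r ?gt_eqF.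
by apply: vposZ ke; rewrite invr_ge0 ltW.
Qed.

(** The cone is closed: a point outside it has a ball outside it, and adding a small multiple of [e]
    does not leave that ball. *)
Lemma vpos_archi x : (forall d, 0 < d -> vpos (d *: e + x)) -> vpos x.
Proof.
move=> H; apply: contrapT => nx.
have : nbhs x (~` (vpos : set V)).
  by apply: open_nbhs_nbhs; split => //; exact/closed_openC/vpos_closed.
move=> /nbhs_ballP[d /= d0]; rewrite -ball_normE => B.
(* Adding 1 keeps the divisor positive even if [e] is zero, and the displacement strictly below
   [d]. *)
have c0 : 0 < `|e| + 1 by rewrite ltr_wpDl.
apply: (B ((d / (`|e| + 1)) *: e + x) _ (H _ _)); last exact: divr_gt0.
rewrite /= opprD addrCA subrr addr0 normrN normrZ ger0_norm; last exact/ltW/divr_gt0.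
by rewrite -mulrA gtr_pMr // mulrC ltr_pdivrMr // mul1r ltrDl.
Qed.

Lemma ounorm_le k x : 0 < k -> vpos (k *: e + x) -> vpos (k *: e - x) -> `|x| <= k.
Proof.
move=> k0 kx kx'; rewrite ounormE; apply: ge_inf => //.
by exists 0 => l [/ltW].
Qed.

(** Admissible scalars come arbitrarily close to the infimum defining the norm, and [vpos_archi]
    passes to the limit. *)
Lemma vle_ounorm x : x <=_V `|x| *: e.
Proof.
apply: vpos_archi => d d0.
have /(inf_adherent d0) [k [k0 kx kx']] :
    has_inf [set k : R | [/\ 0 < k, vpos (k *: e + x) & vpos (k *: e - x)]].
  by split; [have [k ?] := ounitP x; exists k | exists 0 => l [/ltW]].
rewrite -ounormE => /ltW lek.
rewrite addrA -scalerDl; apply: (vle_pos kx').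
apply: vleD; last exact: vle_refl.
by apply: vle_scale; [exact: ounit_pos | rewrite addrC].
Qed.

Lemma vgeN_ounorm x : - (`|x| *: e) <=_V x.
Proof. by rewrite -vleN opprK -normrN; exact: vle_ounorm. Qed.

Lemma ounorm_le1 x : vpos x -> x <=_V e -> `|x| <= 1.
Proof.
move=> x0 xe; apply: ounorm_le; rewrite ?scale1r //.
by apply: vposD => //; exact: ounit_pos.
Qed.

Lemma norm_perp u v (a b : R) : vpos u -> vpos v -> perp u v ->
  `|a *: u + b *: v| = Num.max `|a *: u| `|b *: v|.
Proof.
move=> u0 v0 /(perpP _ _ u0 v0) /(_ u v); rewrite !vle0r.
by apply=> //; exact: vle_refl.
Qed.

Lemma perp_add_le u v : vpos u -> vpos v -> perp u v ->
  u <=_V e -> v <=_V e -> u + v <=_V e.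
Proof.
move=> u0 v0 uv ue ve; apply: (vle_trans (vle_ounorm _)).
rewrite -[X in _ <=_V X]scale1r; apply: vle_scale; first exact: ounit_pos.
have := norm_perp 1 1 u0 v0 uv; rewrite !scale1r => ->.
by rewrite ge_max !ounorm_le1.
Qed.

(** The two parts are orthogonal, so the norm of [x] is the maximum of their norms. *)
Lemma ounorm_pospart x : `|vpospart x| <= `|x|.
Proof.
have := norm_perp 1 (-1) (vpospart_pos x) (vpospart_pos _) (perp_pospart x).
by rewrite scale1r scaleN1r vpospartB => ->; rewrite le_max lexx.
Qed.

(** * Faces and order projections *)

Lemma vface_self u : vpos u -> vface u u.
Proof.
move=> u0; exists 1; rewrite scale1r subrr.
by split=> //; [exact: vposD | exact: vpos0].
Qed.

Lemma vface_pos k u x : vpos x -> 0 < k -> x <=_V k *: u -> vface u x.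
Proof.
move=> x0 k0 xu; exists k; split=> //.
by apply: vposD => //; exact: vle_pos xu.
Qed.

Lemma vfaceN u x : vface u x -> vface u (- x).
Proof. by case=> k [k0 H1 H2]; exists k; rewrite opprK. Qed.

Lemma vfaceD u x y : vface u x -> vface u y -> vface u (x + y).
Proof.
case=> k [k0 H1 H2] [l [l0 H3 H4]]; exists (k + l); split; first exact: addr_gt0.
  by rewrite scalerDl addrACA; exact: vposD.
by rewrite scalerDl opprD addrACA; exact: vposD.
Qed.

Lemma vfaceZ u k : vpos u -> vface u (k *: u).
Proof.
move=> u0; exists (`|k| + 1); rewrite -scalerDl -scalerBl; split.
- by rewrite ltr_wpDl.
- by apply: vposZ => //; have := lerNnormlW (lexx `|k|); lra.
- by apply: vposZ => //; have := ler_norm k; lra.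
Qed.

Lemma oproj_pos p : oproj p -> vpos p.
Proof. by rewrite -vle0r; case. Qed.

Lemma oproj_le p : oproj p -> p <=_V e.
Proof. by case. Qed.

Lemma oproj_complK p : oproj_compl (oproj_compl p) = p.
Proof. by rewrite /oproj_compl opprB addrC addrNK. Qed.

Lemma oproj_perp p : oproj p -> perp p (oproj_compl p).
Proof. by case. Qed.

Lemma oprojC p : oproj p -> oproj (oproj_compl p).
Proof.
case=> p0 pe pp; split; rewrite ?oproj_complK; last exact: perp_sym.
  by rewrite vle0r.
by rewrite /oproj_compl vleBLR; apply: vle_addl; rewrite -vle0r.
Qed.

Lemma vface_perp p x : oproj p -> vpos x -> vface p x -> perp x (oproj_compl p).
Proof.
move=> pP x0 [k [k0 _ kx]]; apply: perp_lel x0 kx.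
apply/perp_sym/perpZr.
- exact/oproj_pos/oprojC.
- exact: oproj_pos.
- exact: ltW.
- exact/perp_sym/oproj_perp.
Qed.

(** Once [x] is normalised, [perp_add_le] applies to it and [p]. *)
Lemma perp_le_ounorm p x : oproj p -> vpos x -> perp x p ->
  x <=_V `|x| *: oproj_compl p.
Proof.
move=> pP x0 xp; have [->|xn0] := eqVneq x 0.
  by rewrite normr0 scale0r; exact: vle_refl.
have n0 : 0 < `|x| by rewrite normr_gt0.
have ni0 : 0 <= `|x|^-1 by rewrite invr_ge0 ltW.
have -> : x = `|x| *: (`|x|^-1 *: x) by rewrite scalerA divff ?scale1r ?gt_eqF.
rewrite {2}scalerA divff ?gt_eqF // scale1r; apply: vleZ; first exact: ltW.
rewrite /oproj_compl -vleBRL; apply: perp_add_le.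
- exact: vposZ.
- exact: oproj_pos.
- by apply/perp_sym/perpZr => //; [exact: oproj_pos | exact: perp_sym].
- by have := vleZ ni0 (vle_ounorm x); rewrite scalerA mulVf ?scale1r ?gt_eqF.
- exact: oproj_le.
Qed.

Lemma perp_vface p x : oproj p -> vpos x -> perp x p -> vface (oproj_compl p) x.
Proof.
move=> pP x0 /(perp_le_ounorm pP x0) le.
have k0 : 0 < `|x| + 1 by rewrite ltr_wpDl.
apply: vface_pos x0 k0 _.
apply: vle_trans le _; apply: vle_scale; last by rewrite lerDl.
exact/oproj_pos/oprojC.
Qed.

(** Replaces the unspecified constant of [vface] by the norm; the limit in [spec_compl_sup] relies
    on this uniformity. *)
Lemma vface_le_ounorm p x : oproj p -> vpos x -> vface p x -> x <=_V `|x| *: p.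
Proof.
move=> pP x0 px; rewrite -[p]oproj_complK.
by apply: perp_le_ounorm => //; [exact: oprojC | exact: vface_perp].
Qed.

Lemma vface_le p x : oproj p -> vpos x -> x <=_V e -> vface p x -> x <=_V p.
Proof.
move=> pP x0 xe px; apply: vle_trans (vface_le_ounorm pP x0 px) _.
rewrite -{2}[p]scale1r; apply: vle_scale; [exact: oproj_pos | exact: ounorm_le1].
Qed.

(** Although [z] may have no sign, [k *: p + z] and [k *: p - z] are positive and orthogonal to the
    complement, and their difference is [z + z]. *)
Lemma vface_abs_perp p z : oproj p -> vface p z -> perp (vabs z) (oproj_compl p).
Proof.
move=> pP [k [k0 kz kz']]; apply: perp_sym.
have face y : vpos (k *: p + y) -> vpos (k *: p - y) ->
    perp (oproj_compl p) (k *: p + y).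
  move=> py py'; apply/perp_sym/vface_perp => //.
  apply: vfaceD; first exact/vfaceZ/oproj_pos.
  by exists k.
have := perp_absB (face _ kz kz') (face (- z) kz' _).
rewrite opprK => /(_ kz); rewrite opprD addrACA subrr add0r opprK vabs_double => P.
by apply: perp_ler P _ _; [exact: vabs_pos | exact/vle_addl/vabs_pos].
Qed.

(** * Uniqueness of compressions, and covers *)

Lemma perpxx x : perp x x -> x = 0.
Proof.
rewrite /perp subrr -(scale0r x) vabsZ normr0 !scale0r => /esym/eqP.
by rewrite -mulr2n -scaler_nat scaler_eq0 pnatr_eq0 => /eqP.
Qed.

(** The absolute value of [x] is orthogonal to [p] and to its complement, hence to [e], hence to a
    multiple of [e] above it, hence to itself. *)
Lemma vface_compl_eq0 p x : oproj p -> vface p x -> vface (oproj_compl p) x -> x = 0.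
Proof.
move=> pP px px'.
have A0 := vabs_pos x.
have xe : perp (vabs x) e.
  have -> : e = oproj_compl p + oproj_compl (oproj_compl p).
    by rewrite oproj_complK /oproj_compl addrNK.
  apply: perpD; [exact/oproj_pos/oprojC | | exact: vface_abs_perp |].
    by rewrite oproj_complK; exact: oproj_pos.
  by apply: vface_abs_perp => //; exact: oprojC.
have abs0 : vabs x = 0.
  apply: perpxx; apply: perp_ler (vle_ounorm (vabs x)) => //.
  by apply: perpZr => //; exact: ounit_pos.
apply: vpos_proper; [have := vabsD_pos x | have := vabsB_pos x].
  by rewrite abs0 add0r.
by rewrite abs0 sub0r.
Qed.

(** Whatever decomposition [xget] picks, it differs from [(x, y)] by elements common to both faces,
    which vanish. *)
Lemma compressionE p v x y : oproj p -> abs_compat_decomposition p v (x, y) ->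
  compression p v = x /\ compression_compl p v = y.
Proof.
move=> pP [/= px py vE]; rewrite /compression /compression_compl.
case: xgetP => [[x' y'] _ [/= px' py' vE']|/(_ (x, y)) []]; last by [].
have xy : x' - x = y - y'.
  by apply/eqP; rewrite subr_eq addrAC eq_sym subr_eq -vE' vE addrC.
have x0 : x' - x = 0.
  apply: (@vface_compl_eq0 p) => //; first exact/vfaceD/vfaceN.
  by rewrite xy; exact/vfaceD/vfaceN.
by split; apply/eqP; [rewrite -subr_eq0 x0 | rewrite eq_sym -subr_eq0 -xy x0].
Qed.

(** The covering hypothesis needs a cover on each side: a cover [r] of [y] is orthogonal to [q], and
    [y] lies below a multiple of [r]. *)
Lemma covers_perp q x y : oproj_covers V -> vpos x -> vpos y -> covers q x ->
  perp x y -> perp q y.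
Proof.
move=> [cov covP] x0 y0 qx xy; have [r ry] := cov y.
have [qP _ _] := qx; have [rP yr _] := ry.
have q0 := oproj_pos qP; have r0 := oproj_pos rP.
have qr : perp q r by apply/perpP => //; exact: covP qx ry ((perpP _ _ x0 y0).1 xy).
by apply: perp_ler (vface_le_ounorm rP y0 yr) => //; exact: perpZr.
Qed.

Lemma covers_le p q x : covers q x -> oproj p -> vface p x -> q <=_V p.
Proof.
move=> [qP qx min] pP px; have q0 := oproj_pos qP.
by apply: vface_le (oproj_le qP) _ => //; exact/(min p)/vface_self.
Qed.

(** The absolute value of [z] is orthogonal to [x], so subtracting [x] affects only the negative
    part. *)
Lemma vpospart_face p x z : oproj p -> vpos x -> vface p x ->
  vface (oproj_compl p) z -> vpospart (z - x) = vpospart z.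
Proof.
move=> pP x0 px pz; have p'P := oprojC pP.
have p0 := oproj_pos pP.
apply: vpospart_sub => //.
apply: (@perp_lel _ _ (`|x| *: p)) => //; last exact: vface_le_ounorm.
apply/perp_sym/perpZr => //; first exact: vabs_pos.
by rewrite -[p]oproj_complK; exact: vface_abs_perp.
Qed.

Lemma vface_pospart p z : oproj p -> vface p z -> vface p (vpospart z).
Proof.
move=> pP pz; rewrite -[p]oproj_complK.
apply: perp_vface; [exact: oprojC | exact: vpospart_pos |].
apply: perp_lel (vpospart_le_abs z); first exact: vface_abs_perp.
exact: vpospart_pos.
Qed.

End AbsOrderUnitTheory.

(** * The spectral family *)

Section SpectralProjections.
Context (R : realType) (V : absOrderUnitType R) (covV : oproj_covers V).
Implicit Types (v x p q : V) (a b c d : R).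

Local Notation e := (@ounit R V).

Definition vcover x : V := xget 0 [set q | covers q x].

Lemma vcoverP x : covers (vcover x) x.
Proof. exact: (xgetPex 0 (covV.1 x)). Qed.

Lemma vcover_oproj x : oproj (vcover x).
Proof. by case: (vcoverP x). Qed.

(* The projection [e - e_a]: the support of [(v - a e)^+]. *)
Definition spec_compl v a : V := vcover (vpospart (v - a *: e)).

Definition spec v a : V := oproj_compl (spec_compl v a).

Lemma spec_compl_oproj v a : oproj (spec_compl v a).
Proof. exact: vcover_oproj. Qed.

Lemma spec_oproj v a : oproj (spec v a).
Proof. exact/oprojC/spec_compl_oproj. Qed.

Lemma vface_spec_compl v a : vface (spec_compl v a) (vpospart (v - a *: e)).
Proof. by case: (vcoverP (vpospart (v - a *: e))). Qed.

Lemma spec_compl_le v a p : oproj p -> vface p (vpospart (v - a *: e)) ->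
  spec_compl v a <=_V p.
Proof. exact/covers_le/vcoverP. Qed.

Lemma vface_spec v a : vface (spec v a) (vpospart (- (v - a *: e))).
Proof.
apply: perp_vface; [exact: spec_compl_oproj | exact: vpospart_pos |].
apply/perp_sym/(covers_perp covV _ _ (vcoverP _)); [| |exact: perp_pospart].
- exact: vpospart_pos.
- exact: vpospart_pos.
Qed.

(** Writes [v] as [a *: e] plus the two parts of [v - a *: e], and splits [e] along [spec v a]. *)
Lemma spec_decomposition v a : abs_compat_decomposition (spec v a) v
  (a *: spec v a - vpospart (- (v - a *: e)),
   a *: spec_compl v a + vpospart (v - a *: e)).
Proof.
split=> /=.
- apply: vfaceD; first exact/vfaceZ/oproj_pos/spec_oproj.
  exact/vfaceN/vface_spec.
- rewrite oproj_complK; apply: vfaceD; last exact: vface_spec_compl.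
  exact/vfaceZ/oproj_pos/spec_compl_oproj.
- rewrite addrACA -scalerDr addrNK [- _ + _]addrC vpospartB.
  by rewrite addrC addrNK.
Qed.

Lemma spec_max v a p : oproj p -> abs_compat p v ->
  compression p v <=_V a *: p ->
  a *: oproj_compl p <=_V compression_compl p v -> p <=_V spec v a.
Proof.
move=> pP [[x y] D]; have [-> ->] := compressionE pP D.
have [/= px py vE] := D => xa ya.
have p'P := oprojC pP.
rewrite vleBC; apply: spec_compl_le => //.
(* The subtracted term is positive and lies under [p], while the first lies under the complement, so
   the positive part stays under the complement. *)
have -> : v - a *: e = (y - a *: oproj_compl p) - (a *: p - x).
  by rewrite vE opprB addrACA -opprD -scalerDr /oproj_compl addrNK [y + x]addrC.
rewrite (vpospart_face pP) //.
- apply: vface_pospart => //; apply: vfaceD => //.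
  exact/vfaceN/vfaceZ/oproj_pos.
- by apply: vfaceD; [exact/vfaceZ/oproj_pos | exact: vfaceN].
- apply: vfaceD => //; exact/vfaceN/vfaceZ/oproj_pos.
Qed.

(** Raising the level by [d] subtracts [d *: e]. Its share off [spec_compl v a] joins the negative
    part, so levels are compared inside a single face. *)
Lemma vpospart_shift v a d : 0 <= d ->
  vpospart (v - (a + d) *: e) =
  vpospart (vpospart (v - a *: e) - d *: spec_compl v a).
Proof.
move=> d0; set p := spec_compl v a; set w := v - a *: e.
have pP : oproj p by exact: spec_compl_oproj.
have p'P := oprojC pP.
have -> : v - (a + d) *: e = (vpospart w - d *: p)
    - (vpospart (- w) + d *: oproj_compl p).
  rewrite scalerDl opprD addrA -/w -{1}(vpospartB w) [in RHS]opprD addrACA.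
  by congr (_ + _); rewrite -opprD -scalerDr /oproj_compl [p + _]addrC addrNK.
rewrite (vpospart_face p'P) //.
- by apply: vposD; [exact: vpospart_pos | apply: vposZ => //; exact: oproj_pos].
- by apply: vfaceD; [exact: vface_spec | exact/vfaceZ/oproj_pos].
- rewrite oproj_complK; apply: vfaceD; first exact: vface_spec_compl.
  exact/vfaceN/vfaceZ/oproj_pos.
Qed.

Lemma spec_compl_mono v a b : a <= b -> spec_compl v b <=_V spec_compl v a.
Proof.
move=> ab; have pP := spec_compl_oproj v a.
apply: spec_compl_le => //; have -> : b = a + (b - a) by rewrite addrC addrNK.
rewrite vpospart_shift ?subr_ge0 //; apply: vface_pospart => //.
apply: vfaceD; first exact: vface_spec_compl.
exact/vfaceN/vfaceZ/oproj_pos.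
Qed.

Lemma spec_mono v a b : a <= b -> spec v a <=_V spec v b.
Proof. by move=> ab; exact/vleB2l/spec_compl_mono. Qed.

(* With [w = v - a e] and [q = spec_compl v a], one has
   [w^+ <= (w - d e)^+ + d q <= (|w| + d) r + d e] for every [d > 0]. *)
Lemma spec_compl_sup v a r : oproj r ->
  (forall c, a < c -> spec_compl v c <=_V r) -> spec_compl v a <=_V r.
Proof.
move=> rP H; have r0 := oproj_pos rP; apply: spec_compl_le => //.
set w := v - a *: e; pose k := `|w| + 1.
have k0 : 0 < k by rewrite ltr_wpDl.
apply: vface_pos k0 _; first exact: vpospart_pos.
have /(vle_scale r0) : `|w| <= k by rewrite lerDl.
apply: vle_trans.
(* The error has two pieces, [h *: r] and [h *: spec_compl v a], each at most [h *: e]; hence the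
   halving of [d]. *)
apply: vpos_archi => d d0; have h0 : 0 < d / 2 by exact: divr_gt0.
set h := d / 2 in h0; have hd : d = h + h by rewrite /h; lra.
have ah : a < a + h by rewrite ltrDl.
set z := vpospart (v - (a + h) *: e).
have zr : z <=_V (`|w| + h) *: r.
  apply: (vle_trans (vface_le_ounorm (spec_compl_oproj v (a + h)) _ _)).
  - exact: vpospart_pos.
  - exact: vface_spec_compl.
  apply: (vle_trans (vleZ _ (H _ ah))) => //.
  apply: vle_scale => //; apply: (le_trans (ounorm_pospart _)).
  rewrite scalerDl opprD addrA; apply: (le_trans (ler_normB _ _)).
  rewrite lerD2l normrZ gtr0_norm // ler_piMr //; first exact: ltW.
  exact: ounorm_le1 (@ounit_pos _ _) (vle_refl _).
have wz : vpospart w <=_V z + h *: spec_compl v a.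
  by rewrite -vleBLR /z vpospart_shift ?ltW //; exact: vle_pospart.
suff : vpospart w <=_V `|w| *: r + d *: e.
  by rewrite /vle addrA [d *: e + _]addrC.
apply: vle_trans wz _; rewrite hd scalerDl addrA.
apply: vleD; last by apply: vleZ; [exact: ltW | exact/oproj_le/spec_compl_oproj].
apply: (vle_trans zr); rewrite scalerDl; apply: vleD; first exact: vle_refl.
by apply: vleZ; [exact: ltW | exact: oproj_le].
Qed.

(* If [s] is the supremum of the projections [spec_compl v c], [c > a], and
   [t] covers [e - s], then [t] is orthogonal to each of them, so all of them
   lie below the projection [e - t], which in turn lies below [s]. *)
Lemma spec_right_continuous v a : monotone_complete V ->
  is_vinf [set spec v b | b in [set b | a < b]] (spec v a).
Proof.
move=> mcV; split=> [_ [b /ltW ab <-]|f Hf]; first exact: spec_mono.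
(* The complements decrease with the level, so the index order is reversed to make the net
   increasing. *)
pose I := {b : R | a < b}; pose leI (i j : I) := sval j <= sval i.
have dir : directed_preorder leI.
  split.
  - by constructor; exists (a + 1); rewrite ltrDl.
  - by move=> i; exact: lexx.
  - by move=> i j k ij jk; exact: le_trans jk ij.
  - move=> i j; have ak : a < Num.min (sval i) (sval j).
      by rewrite lt_min (svalP i) (svalP j).
    exists (exist _ (Num.min (sval i) (sval j)) ak : I).
    by rewrite /leI /= !ge_min !lexx orbT.
have [||s [ubs lubs]] := mcV I leI (fun i => spec_compl v (sval i)) dir.
- by move=> i j; exact: spec_compl_mono.
- by exists e => i; exact/oproj_le/spec_compl_oproj.
have {}ubs c : a < c -> spec_compl v c <=_V s.
  by move=> ac; apply: ubs; exists (exist _ c ac : I).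
have {}lubs (x : V) : (forall c, a < c -> spec_compl v c <=_V x) -> s <=_V x.
  by move=> Hx; apply: lubs => _ [i _ <-]; exact/Hx/(svalP i).
have s0 : vpos s.
  apply: vle_pos (ubs (a + 1) _); last by rewrite ltrDl.
  exact/oproj_pos/spec_compl_oproj.
have es0 : vpos (e - s) by apply: lubs => c _; exact/oproj_le/spec_compl_oproj.
pose t := vcover (e - s); have tP : oproj t by exact: vcover_oproj.
have t'P := oprojC tP.
(* Since [e - s] is at most [e] and lies in the face of its cover [t], it is below [t]. *)
have ts : oproj_compl t <=_V s.
  rewrite /oproj_compl vleBLR addrC -vleBLR; apply: vface_le => //.
    by rewrite vleBLR; exact: vle_addl.
  by case: (vcoverP (e - s)).
(* The bound goes through [e - s]: first [spec_compl v a] is placed below [s], then [f] below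
   [e - s]. *)
apply/(vle_trans _ (vleB2l _ _)); last first.
  (* [spec_compl_sup] requires a projection, which [s] is not known to be; [oproj_compl t] takes its
     place. *)
  apply: vle_trans ts; apply: spec_compl_sup => // c ac.
  have cP := spec_compl_oproj v c; have c0 := oproj_pos cP.
  rewrite /oproj_compl -vleBRL addrC; apply: perp_add_le => //.
  - exact: oproj_pos.
  - apply: (covers_perp covV es0 c0 (vcoverP _)); apply/perp_sym.
    apply: (perp_ler (oproj_perp cP)) => //; exact/vleB2l/ubs.
  - exact: oproj_le.
  - exact: oproj_le.
rewrite vleBC; apply: lubs => c ac; rewrite vleBC; apply: Hf.
by exists c.
Qed.

(** Here [v - a *: e] dominates a positive multiple of [e], so [e] itself lies in the face of the
    cover. *)
Lemma spec_lt v a : a < - `|v| -> spec v a = 0.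
Proof.
move=> av; have pP := spec_compl_oproj v a.
have d0 : 0 < - `|v| - a by rewrite subr_gt0.
have wE : (- `|v| - a) *: e <=_V v - a *: e.
  rewrite scalerBl scaleNr; apply: vleD; [exact: vgeN_ounorm | exact: vle_refl].
have w0 : vpos (v - a *: e).
  by apply: vle_pos wE; apply: vposZ (ltW d0) (@ounit_pos _ _).
have := vface_spec_compl v a; rewrite vpospart_id // => /(vface_le_ounorm pP w0) wp.
apply: vle_anti; last by rewrite vle0r; exact/oproj_pos/spec_oproj.
rewrite /spec /oproj_compl vleBLR add0r.
apply: vface_le (vle_refl _) _ => //; first exact: ounit_pos.
(* The first factor undoes the multiple of [e] below [v - a *: e]; the second bounds that vector by
   a multiple of its cover, with 1 added for strict positivity. *)
apply: (@vface_pos _ _ ((- `|v| - a)^-1 * (`|v - a *: e| + 1))).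
- exact: ounit_pos.
- by rewrite mulr_gt0 ?invr_gt0 // ltr_wpDl.
- rewrite -scalerA -{1}[e](scalerK (lt0r_neq0 d0)).
  apply: vleZ; first by rewrite invr_ge0 ltW.
  apply: vle_trans wE _; apply: vle_trans wp _; apply: vle_scale.
    exact: oproj_pos.
  by rewrite lerDl.
Qed.

Lemma oproj0 : oproj (0 : V).
Proof.
split; [exact: vle_refl | by rewrite vle0r; exact: ounit_pos |].
by rewrite /oproj_compl subr0; exact/perp0l/ounit_pos.
Qed.

Lemma spec_ge v a : `|v| <= a -> spec v a = e.
Proof.
move=> va; rewrite /spec /oproj_compl; suff -> : spec_compl v a = 0 by rewrite subr0.
apply: vle_anti; last by rewrite vle0r; exact/oproj_pos/spec_compl_oproj.
apply: spec_compl_le oproj0 _; rewrite vpospart_npos.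
  exact/vface_self/vpos0.
rewrite opprB; apply: vle_trans (vle_ounorm v) _.
by apply: vle_scale va; exact: ounit_pos.
Qed.

End SpectralProjections.

Theorem theorem7p10 (R : realType) (V : absOrderUnitType R)
    (mcV : monotone_complete V) (covV : oproj_covers V) (v : V) :
  exists! E : R -> V,
    (forall a : R, oproj (E a)) /\
    (forall a b : R, a <= b -> E a <=_V E b) /\
    (forall a : R, (a < - `|v| -> E a = 0) /\ (`|v| <= a -> E a = ounit)) /\
    (forall a : R, abs_compat (E a) v) /\
    (forall a : R,
       compression (E a) v <=_V a *: E a /\
       a *: oproj_compl (E a) <=_V compression_compl (E a) v) /\
    (forall (a : R) (p : V), oproj p -> abs_compat p v ->
       compression p v <=_V a *: p ->
       a *: oproj_compl p <=_V compression_compl p v ->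
       p <=_V E a) /\
    (forall a0 : R, is_vinf [set E a | a in [set b : R | a0 < b]] (E a0)).
Proof.
have D a := spec_decomposition covV v a.
have C a : compression (spec v a) v <=_V a *: spec v a /\
    a *: oproj_compl (spec v a) <=_V compression_compl (spec v a) v.
  (* With explicit components, both inequalities reduce to positivity of the Jordan parts. *)
  have [-> ->] := compressionE (spec_oproj covV v a) (D a).
  rewrite oproj_complK; split; last exact/vle_addl/vpospart_pos.
  by rewrite vleBLR; exact/vle_addl/vpospart_pos.
have AC a : abs_compat (spec v a) v by eexists; exact: D.
exists (spec v); split.
  split; first exact: spec_oproj.
  split; first exact: spec_mono.
  split; first by move=> a; split; [exact: spec_lt | exact: spec_ge].
  do 3!split=> //; last by move=> a; exact: spec_right_continuous.
  by move=> a p; exact: spec_max.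
(* Each family meets the conditions under which the other is maximal, so the two inequalities follow
   symmetrically. *)
move=> F [FP [_ [_ [FAC [FC [Fmax _]]]]]]; apply/funext => a.
apply: vle_anti.
  by have [? ?] := C a; apply: Fmax => //; exact: spec_oproj.
by have [? ?] := FC a; exact: spec_max.
Qed.
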